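(* Let $n\ge 0$ and let $G=\mathbb Z^n\rtimes \mathcal C_2$ be a semidirect product (for any action of $\mathcal C_2$ on $\mathbb Z^n$ by automorphisms). Then $G$ has trivial weak Cayley table group, i.e. $\mathcal W(G)=\mathcal W_0(G)$.
   Context: For a group $G$, $\sim$ denotes conjugacy in $G$. The weak Cayley table group $\mathcal W(G)$ is the group (under composition) of all bijections $f:G\to G$ such that $f(g_1g_2)\sim f(g_1)f(g_2)$ for all $g_1,g_2\in G$. It contains $\operatorname{Aut}(G)$ and the inversion map $\iota:g\mapsto g^{-1}$; $\mathcal W_0(G)=\langle \operatorname{Aut}(G),\iota\rangle$. $\mathcal C_m$ denotes the cyclic group of order $m$. *)

(* Defs.v *)
From HB Require Import structures.
From mathcomp Require Import all_boot all_fingroup all_algebra.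
From mathcomp Require Import classical_sets.
Set Implicit Arguments.
Unset Strict Implicit.
Unset Printing Implicit Defensive.
Import GRing.Theory.
Local Open Scope group_scope.
Local Open Scope classical_set_scope.

(* An action of H on V by automorphisms of the additive group V, i.e., a
   homomorphism H -> Aut V. Bijectivity of each [to h] follows from the
   axioms, its inverse being [to h^-1]. *)
Record autAction (H : groupType) (V : zmodType) := AutAction {
  aut_act :> H -> V -> V;
  aut_actD : forall h, {morph aut_act h : v w / (v + w)%R};
  aut_act1 : forall v, aut_act 1 v = v;
  aut_actM : forall h k v, aut_act (h * k) v = aut_act h (aut_act k v)
}.

(* The group structure is
   (v, h)(w, k) = (v + h.w, hk), with V written additively. *)
Record semidirect (H : groupType) (V : zmodType) (to : autAction H V) :=
  SemiDirect { sd_vect : V; sd_elt : H }.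

Section SemidirectGroup.
Variables (H : groupType) (V : zmodType) (to : autAction H V).
Local Notation sdT := (semidirect to).

Definition sd_pair (x : sdT) : V * H := (sd_vect x, sd_elt x).
Definition pair_sd (p : V * H) : sdT := SemiDirect to p.1 p.2.

Lemma sd_pairK : cancel sd_pair pair_sd.
Proof. by case. Qed.

HB.instance Definition _ := Choice.copy sdT (can_type sd_pairK).

Definition sd_one : sdT := SemiDirect to 0%R 1.
Definition sd_mul (x y : sdT) : sdT :=
  SemiDirect to (sd_vect x + to (sd_elt x) (sd_vect y))%R
    (sd_elt x * sd_elt y)%g.
Definition sd_inv (x : sdT) : sdT :=
  SemiDirect to (to (sd_elt x)^-1%g (- sd_vect x)%R) (sd_elt x)^-1.

Lemma aut_act0 h : to h 0%R = 0%R.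
Proof. by apply: (addrI (to h 0%R)); rewrite -aut_actD !addr0. Qed.

Lemma sd_mulA : associative sd_mul.
Proof.
by case=> [u g] [v h] [w k]; rewrite /sd_mul /= aut_actD aut_actM addrA mulgA.
Qed.

Lemma sd_mul1 : left_id sd_one sd_mul.
Proof. by case=> [v h]; rewrite /sd_mul /= aut_act1 add0r mul1g. Qed.

Lemma sd_mulr1 : right_id sd_one sd_mul.
Proof. by case=> [v h]; rewrite /sd_mul /= aut_act0 addr0 mulg1. Qed.

Lemma sd_mulV : left_inverse sd_one sd_inv sd_mul.
Proof.
by case=> [v h]; rewrite /sd_mul /= -aut_actD addNr aut_act0 mulVg.
Qed.

Lemma sd_mulrV : right_inverse sd_one sd_inv sd_mul.
Proof.
by case=> [v h]; rewrite /sd_mul /= -aut_actM mulgV aut_act1 addrN.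
Qed.

HB.instance Definition _ :=
  isGroup.Build sdT sd_mulA sd_mul1 sd_mulr1 sd_mulV sd_mulrV.

End SemidirectGroup.

Section WeakCayley.
Variable G : groupType.

Definition conjugate_elts (x y : G) : Prop := exists g : G, y = x ^ g.

Definition weak_cayley_group : set (G -> G) :=
  [set f | bijective f /\
     forall g1 g2 : G, conjugate_elts (f (g1 * g2)) (f g1 * f g2)].

Definition automorphisms : set (G -> G) :=
  [set f | bijective f /\ {morph f : x y / x * y}].

(* A is a subgroup of the symmetric group on the underlying set of G. *)
Definition permutation_group (A : set (G -> G)) : Prop :=
  [/\ forall f, A f -> bijective f,
      A id,
      forall f g, A f -> A g -> A (f \o g) &
      forall f g, A f -> cancel f g -> cancel g f -> A g].

Definition weak_cayley_group0 : set (G -> G) :=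
  smallest permutation_group (automorphisms `|` [set fun x => x^-1]).

End WeakCayley.

Arguments automorphisms G : clear implicits.
Arguments weak_cayley_group G : clear implicits.
Arguments weak_cayley_group0 G : clear implicits.

(* Main.v *)
Require Import Defs.
From mathcomp Require Import all_boot all_fingroup all_algebra.
From mathcomp Require Import boolp classical_sets.

(** Write G = V ⋊ <t>, let s be the action of t on V, and let f be in W(G). If
s = 1 then G is abelian and f is a morphism. Otherwise the class of vt contains
the three elements vt, (v + k)t, (v + 2k)t with k = w - s w <> 0, whereas the
classes inside V are the {v, s v}; hence f preserves V and Vt, so that
f(v) = A v and f(vt) = (B v)t. The conjugacy A (a + b) ~ A a + A b, applied to
(a, b), (a + b, -b) and (a + b, -a), forces A to be additive, and A commutes
with s. Put c = B 0, so that s c = -c. Comparing A (v + s w) with B v + s (B w) shows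
that either B v = A v + c for all v, and then f is an automorphism, or
B v = s (A v) + c for all v, and then f is an anti-automorphism. *)

Set Implicit Arguments.
Unset Strict Implicit.
Unset Printing Implicit Defensive.
Import GRing.Theory.
Local Open Scope group_scope.
Local Open Scope classical_set_scope.

(** * Weak Cayley table maps and $\mathcal W_0$ for an arbitrary group *)

Section WeakCayleyMaps.
Variable G : groupType.
Implicit Types (x y : G) (f : G -> G).

Lemma conjugate_elts_mulC x y : conjugate_elts (x * y) (y * x).
Proof. by exists x; rewrite conjgE mulgA mulKg. Qed.

Lemma conjugate_elts_eq1 x : conjugate_elts x 1 -> x = 1.
Proof. by case=> g /esym/eqP; rewrite conjg_eq1 => /eqP. Qed.

Lemma weak_cayley1 f : weak_cayley_group G f -> f 1 = 1.
Proof.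
(* Multiplying the preimage of [(f 1)^-1] by [1] makes [(f 1)^-1] conjugate to [1]. *)
case=> [[g fK gK]] /(_ (g (f 1)^-1) 1); rewrite mulg1 gK mulVg.
by move=> /conjugate_elts_eq1 /eqP; rewrite invg_eq1 => /eqP.
Qed.

(** [x] and [x ^ y] are the products of [x * y] and [y^-1] in the two orders. The link [z] makes
    [f x] and [f (x ^ y)] conjugate to each other. *)
Lemma weak_cayley_conj f x y : weak_cayley_group G f ->
  exists z, [/\ conjugate_elts (f x) z & conjugate_elts (f (x ^ y)) z].
Proof.
move=> [_ fM]; have [g gE] := fM y^-1 (x * y); have [h hE] := fM (x * y) y^-1.
exists (f y^-1 * f (x * y)); split; last by exists g; rewrite conjgE.
have [k ->] := conjugate_elts_mulC (f (x * y)) (f y^-1).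
by exists (h * k); rewrite hE mulgK conjgM.
Qed.

(** Explicit form of $\mathcal W_0(G)$: an anti-automorphism is an automorphism followed by
    inversion. *)
Definition morph_or_antimorph : set (G -> G) :=
  [set f | bijective f /\
     ({morph f : x y / x * y} \/ forall x y, f (x * y) = f y * f x)].

Lemma morph_or_antimorph_group : permutation_group morph_or_antimorph.
Proof.
split.
- by move=> f [].
- by split; [exists id | left].
- move=> f g [bf fM] [bg gM]; split; first exact: bij_comp.
  by case: fM => fM; case: gM => gM; [left|right|right|left] => x y /=;
     rewrite gM fM.
- move=> f g [bf fM] fK gK; split; first by exists f.
  by case: fM => fM; [left|right] => x y; apply: (can_inj fK);
     rewrite fM !gK.
Qed.

Lemma weak_cayley_group0E : weak_cayley_group0 G = morph_or_antimorph.
Proof.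
apply/seteqP; split=> f.
  apply; split; first exact: morph_or_antimorph_group.
  move=> g [[bg gM] | ->]; first by split=> //; left.
  by split; [exact: inv_bij invgK | right => x y; rewrite invMg].
move=> [bf fM] A [[_ _ Acomp _] sA].
have Ainv : A (fun x => x^-1) by apply: sA; right.
case: fM => fM; first by apply: sA; left.
have -> : f = (fun x => x^-1) \o (fun x => (f x)^-1).
  by apply/funext => x /=; rewrite invgK.
apply: (Acomp) => //; apply: sA; left; split.
  exact: (bij_comp (inv_bij (@invgK G)) bf).
by move=> x y; rewrite fM invMg.
Qed.

Lemma morph_or_antimorph_sub : morph_or_antimorph `<=` weak_cayley_group G.
Proof.
move=> f [bf fM]; split=> // x y.
case: fM => ->; last exact: conjugate_elts_mulC.
by exists 1; rewrite conjg1.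
Qed.

End WeakCayleyMaps.

(** * Products and conjugacy classes in $V\rtimes\mathcal C_2$, with $V$ free of 2-torsion *)

Section SemidirectZ2.
Variables (V : zmodType) (to : autAction 'Z_2 V).
Hypothesis V2_torsion_free : forall v : V, (v + v = 0 -> v = 0)%R.

Local Notation G := (semidirect to).
(* The generator of [C_2]; [1%g : 'Z_2] is the residue [0]. *)
Local Notation tau := (1%R : 'Z_2).
Local Notation s := (to tau).
Local Notation vec v := (SemiDirect to v 1 : G).
Local Notation refl v := (SemiDirect to v tau : G).
Implicit Types (a b u v w : V) (f : G -> G).

Lemma tau2 : tau * tau = 1. Proof. exact: val_inj. Qed.

Lemma actK : involutive s.
Proof. by move=> v; rewrite -aut_actM tau2 aut_act1. Qed.

Lemma actN : {morph s : v / (- v)%R}.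
Proof.
by move=> v; apply: (addrI (s v)); rewrite -aut_actD !subrr aut_act0.
Qed.

Lemma actB : {morph s : v w / (v - w)%R}.
Proof. by move=> v w; rewrite aut_actD actN. Qed.

Lemma sdP (P : G -> Prop) :
  (forall v, P (vec v)) -> (forall v, P (refl v)) -> forall x, P x.
Proof.
move=> Pi Pj [v h].
have [->|->] // : h = 1 \/ h = tau.
by case: h => [[|[|//]]] ?; [left|right]; apply: val_inj.
Qed.

Lemma sd_mulE (x y : G) : x * y =
  SemiDirect to (sd_vect x + to (sd_elt x) (sd_vect y))%R (sd_elt x * sd_elt y).
Proof. by []. Qed.

Lemma mul_vv v w : vec v * vec w = vec (v + w).
Proof. by rewrite sd_mulE /= aut_act1 mulg1. Qed.

Lemma mul_vr v w : vec v * refl w = refl (v + w).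
Proof. by rewrite sd_mulE /= aut_act1 mul1g. Qed.

Lemma mul_rv v w : refl v * vec w = refl (v + s w).
Proof. by rewrite sd_mulE /= mulg1. Qed.

Lemma mul_rr v w : refl v * refl w = vec (v + s w).
Proof. by rewrite sd_mulE /= tau2. Qed.

Definition mulE := (mul_vv, mul_vr, mul_rv, mul_rr).

Lemma vec_inj v w : vec v = vec w -> v = w. Proof. by case. Qed.
Lemma refl_inj v w : refl v = refl w -> v = w. Proof. by case. Qed.
Lemma vec_neq_refl v w : vec v <> refl w. Proof. by case. Qed.

Lemma inv_v v : (vec v)^-1 = vec (- v).
Proof. by apply: (mulgI (vec v)); rewrite mulgV mulE subrr. Qed.

Lemma inv_r v : (refl v)^-1 = refl (- s v).
Proof. by apply: (mulgI (refl v)); rewrite mulgV mulE actN actK subrr. Qed.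

Definition invE := (inv_v, inv_r).

Lemma conj_vec v (x : G) : conjugate_elts (vec v) x ->
  exists2 w, x = vec w & w = v \/ w = s v.
Proof.
case=> y ->; rewrite conjgE; elim/sdP: y => w; rewrite !(mulE, invE).
  by exists v; [rewrite addrC -addrA subrr addr0 | left].
exists (s v); last by right.
by congr (vec _); rewrite aut_actD addrCA addNr addr0.
Qed.

Lemma conj_vecP v w : conjugate_elts (vec v) (vec w) -> w = v \/ w = s v.
Proof. by case/conj_vec=> u /vec_inj ->. Qed.

Lemma conj_refl v (x : G) : conjugate_elts (refl v) x -> exists w, x = refl w.
Proof.
case=> y ->; rewrite conjgE.
by elim/sdP: y => w; rewrite !(mulE, invE); eexists.
Qed.

Lemma refl_conj v w : refl v ^ vec w = refl (v - (w - s w)).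
Proof.
by rewrite conjgE !(mulE, invE) opprB addrCA [(- w + _)%R]addrC.
Qed.

(** * Nontrivial action: preservation of $V$ and of its other coset *)

Section NontrivialAction.
Variables (f : G -> G) (w0 : V).
Hypotheses (fW : weak_cayley_group G f) (w0P : s w0 <> w0).

(** If [f (refl v) = vec u], then [f] sends the class of [refl v] into [{vec u, vec (s u)}], too
    small for three distinct conjugates. *)
Lemma weak_cayley_refl v : exists w, f (refl v) = refl w.
Proof.
case E: (f (refl v)) => [u h].
elim/sdP: {u h}(SemiDirect to u h) E => u; last by exists u.
have [fB _] := fW; have f_inj := bij_inj fB.
move=> Eu; exfalso.
have fcl w : f (refl v ^ vec w) = vec u \/ f (refl v ^ vec w) = vec (s u).
  have [z []] := weak_cayley_conj (refl v) (vec w) fW.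
  rewrite Eu => /conj_vec[z' -> z'E].
  elim/sdP: (f _) => y; last by case/conj_refl => ? /vec_neq_refl.
  case/conj_vecP=> z'y.
    by rewrite -z'y; case: z'E => ->; [left|right].
  have -> : y = s z' by rewrite z'y actK.
  by case: z'E => ->; rewrite ?actK; [right|left].
pose k := (w0 - s w0)%R.
have k0 : k <> 0%R by move/eqP; rewrite subr_eq0 => /eqP/esym.
have k2 : (k + k <> 0)%R by move/V2_torsion_free.
have E1 : refl v ^ vec w0 = refl (v - k) by rewrite refl_conj.
have E2 : refl v ^ vec (w0 + w0) = refl (v - (k + k)).
  by rewrite refl_conj aut_actD [(- (s w0 + _))%R]opprD addrACA.
(* The value [vec u] is taken by [refl v]; once [vec (s u)] is taken too, none is left for
   [refl (v - (k + k))]. *)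
have f1 : f (refl (v - k)) = vec (s u).
  have := fcl w0; rewrite E1 -Eu => -[/f_inj/refl_inj/eqP|//].
  by rewrite -subr_eq0 addrAC subrr sub0r oppr_eq0 => /eqP.
have := fcl (w0 + w0)%R; rewrite E2 => -[].
  rewrite -Eu => /f_inj/refl_inj/eqP.
  by rewrite -subr_eq0 addrAC subrr sub0r oppr_eq0 => /eqP.
by rewrite -f1 => /f_inj/refl_inj/addrI/oppr_inj/eqP;
  rewrite -subr_eq0 addrK => /eqP.
Qed.

(** [vec v] is [refl v * refl 0], and the images of these two factors multiply into $V$. *)
Lemma weak_cayley_vec v : exists w, f (vec v) = vec w.
Proof.
have [_ fM] := fW; have := fM (refl v) (refl 0%R).
have [a ->] := weak_cayley_refl v; have [b ->] := weak_cayley_refl 0%R.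
rewrite !mulE aut_act0 addr0.
by elim/sdP: (f _) => w; [exists w | case/conj_refl => ? /vec_neq_refl].
Qed.

(** * The components [A] and [B] of [f] on the two cosets of $V$ *)

Variables A B : V -> V.
Hypotheses (fA : forall v, f (vec v) = vec (A v))
  (fB : forall v, f (refl v) = refl (B v)).

Lemma vec_part_conj a b :
  (A a + A b = A (a + b) \/ A a + A b = s (A (a + b)))%R.
Proof.
have [_ /(_ (vec a) (vec b))] := fW.
by rewrite mulE !fA mulE => /conj_vecP.
Qed.

Lemma refl_part_conj a b :
  (B a + s (B b) = A (a + s b) \/ B a + s (B b) = s (A (a + s b)))%R.
Proof.
have [_ /(_ (refl a) (refl b))] := fW.
by rewrite mulE !fB mulE fA => /conj_vecP.
Qed.

Lemma vec_part_inj : injective A.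
Proof.
move=> a b ab; have [bf _] := fW; apply/vec_inj/(bij_inj bf).
by rewrite !fA ab.
Qed.

Lemma vec_part0 : A 0 = 0%R.
Proof. by have := weak_cayley1 fW; rewrite -[1]/(vec 0) fA => /vec_inj. Qed.

Lemma vec_partN v : A (- v) = (- A v)%R.
Proof.
apply/eqP; rewrite -addr_eq0 addrC; apply/eqP.
by case: (vec_part_conj v (- v)); rewrite subrr vec_part0 ?aut_act0.
Qed.

Lemma vec_partD a b : (A (a + b) = A a + A b)%R.
Proof.
case: (vec_part_conj a b) => [<- // | E].
have Eab : (A (a + b) = s (A a) + s (A b))%R by rewrite -aut_actD E actK.
(* The pair [(u + v, - v)] gives this dichotomy. Used in both orders, it leaves only the case where
   [s] fixes [A a] and [A b], and there [Eab] is additivity. *)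
have fix_part u v : (A (u + v) = s (A u) + s (A v) ->
    A (u + v) = A u + A v \/ s (A v) = A v)%R.
  move=> Euv; case: (vec_part_conj (u + v) (- v)); rewrite addrK vec_partN.
    by move=> <-; left; rewrite subrK.
  rewrite Euv -addrA -[RHS]addr0 => /addrI/eqP.
  by rewrite subr_eq0 => /eqP; right.
case: (fix_part _ _ Eab) => // fb.
have := fix_part b a; rewrite [(b + a)%R]addrC [(s (A b) + _)%R]addrC.
rewrite [(A b + _)%R]addrC => /(_ Eab) [// | fa].
by rewrite Eab fa fb.
Qed.

(** Conjugation by [refl 0] takes [vec a] to [vec (s a)], so [A (s a)] is [A a] or [s (A a)];
    injectivity excludes the first. *)
Lemma vec_part_act_nonfixed a : s a <> a -> A (s a) = s (A a).
Proof.
move=> sa; have [z []] := weak_cayley_conj (vec a) (refl 0%R) fW.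
rewrite conjgE !(mulE, invE) aut_act0 oppr0 add0r addr0 !fA.
case/conj_vec=> z' -> z'E /conj_vecP z'A.
have [/vec_part_inj|] // : A (s a) = A a \/ A (s a) = s (A a).
by case: z'A z'E => -> // [<-|/(can_inj actK) <-]; rewrite ?actK; [right|left].
Qed.

Lemma vec_part_act a : A (s a) = s (A a).
Proof.
case: (EM (s a = a)) => [sa | /vec_part_act_nonfixed //].
(* A fixed [a] is the difference of the moved vectors [a + w0] and [w0]. *)
have /vec_part_act_nonfixed : s (a + w0)%R <> (a + w0)%R.
  by rewrite aut_actD sa => /addrI.
rewrite aut_actD !vec_partD aut_actD (vec_part_act_nonfixed w0P).
by move/addIr.
Qed.

(** [refl 0] is an involution, so the square of its image is conjugate to [1]. *)
Lemma act_refl_part0 : s (B 0) = (- B 0)%R.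
Proof.
apply/eqP; rewrite -addr_eq0 addrC; apply/eqP.
case: (refl_part_conj 0%R 0%R); rewrite aut_act0 addr0 vec_part0 //.
by rewrite aut_act0.
Qed.

Local Notation C v := (B v - B 0)%R.

Lemma refl_part_conj_shift a b :
  (C a + s (C b) = A a + s (A b) \/ C a + s (C b) = s (A a) + A b)%R.
Proof.
have -> : (C a + s (C b) = B a + s (B b))%R.
  by rewrite actB act_refl_part0 opprK addrACA addNr addr0.
have := refl_part_conj a b.
by rewrite vec_partD aut_actD vec_part_act actK.
Qed.

Lemma refl_part_cases v : C v = A v \/ C v = s (A v).
Proof.
have := refl_part_conj_shift v 0%R.
by rewrite subrr vec_part0 aut_act0 !addr0.
Qed.

(** If [a] violates the first alternative and [b] the second, then [C a + s (C b)] is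
    [s (A a) + s (A b)]; either value allowed for the pair removes one violation. *)
Lemma refl_part_uniform :
  (forall v, C v = A v) \/ (forall v, C v = s (A v)).
Proof.
apply: contrapT => /not_orP[/existsNP[a Ca] /existsNP[b Cb]].
have Ca' : C a = s (A a) by case: (refl_part_cases a).
have Cb' : C b = A b by case: (refl_part_cases b).
case: (refl_part_conj_shift a b); rewrite Ca' Cb'.
  by move/addIr => E; apply: Ca; rewrite Ca'.
by move/addrI => E; apply: Cb; rewrite Cb'.
Qed.

Lemma weak_cayley_morph_or_antimorph : morph_or_antimorph f.
Proof.
have [bf _] := fW; split=> //.
have [c sc BE] : exists2 c : V, s c = (- c)%R &
    (forall v, B v = A v + c)%R \/ (forall v, B v = s (A v) + c)%R.
  exists (B 0); first exact: act_refl_part0.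
  by case: refl_part_uniform => CE; [left|right] => v; rewrite -CE subrK.
(* Four products of cosets in each case; in [refl v * refl w] the constants cancel because
   [s c = - c]. *)
case: BE => BE; [left | right]; elim/sdP=> v; elim/sdP=> w;
  rewrite !mulE !(fA, fB) !mulE ?BE ?vec_partD ?vec_part_act ?aut_actD ?actK.
- by [].
- by rewrite addrA.
- by rewrite addrAC.
- by rewrite sc addrACA subrr addr0.
- by rewrite addrC.
- by rewrite [(s (A v) + _)%R]addrC addrAC.
- by rewrite addrCA addrA.
- by rewrite sc addrACA subrr addr0 addrC.
Qed.

End NontrivialAction.

(** * The trivial action, where $G$ is abelian, and the conclusion *)

Lemma trivial_action_morph f : (forall v, s v = v) ->
  weak_cayley_group G f -> {morph f : x y / x * y}.
Proof.
move=> s1 [_ fM] x y; have [g ->] := fM x y.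
have mulC (x' y' : G) : x' * y' = y' * x'.
  by elim/sdP: x' => v; elim/sdP: y' => w; rewrite !mulE ?s1 addrC.
by rewrite conjgE [RHS]mulC mulgK.
Qed.

Lemma weak_cayley_semidirectZ2 : weak_cayley_group G = weak_cayley_group0 G.
Proof.
rewrite weak_cayley_group0E; apply/seteqP; split=> [f fW|]; last first.
  exact: morph_or_antimorph_sub.
case: (EM (forall v, s v = v)) => [s1 | /existsNP[w0 w0P]].
  by split; [case: fW | left; exact: trivial_action_morph].
have [A fA] := choice (weak_cayley_vec fW w0P).
have [B fB] := choice (weak_cayley_refl fW w0P).
exact: weak_cayley_morph_or_antimorph fW w0P A B fA fB.
Qed.

End SemidirectZ2.

Theorem theorem1p2 (n : nat) (to : autAction 'Z_2 'rV[int]_n) :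
  weak_cayley_group (semidirect to) = weak_cayley_group0 (semidirect to).
Proof.
apply: weak_cayley_semidirectZ2 => v /matrixP v2.
(* Absence of 2-torsion in $\mathbb Z^n$ is checked on coordinates. *)
apply/matrixP => i j; have := v2 i j; rewrite !mxE => /eqP.
by rewrite -mulr2n Num.Theory.mulrn_eq0 => /eqP.
Qed.
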